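(* Let $\mathbb{H}_1,\ldots,\mathbb{H}_n$ be complex Hilbert spaces and let $T=(A_{ij})$ be an $n\times n$ operator matrix with $A_{ij}\in B(\mathbb{H}_j,\mathbb{H}_i)$, acting on $\mathbb{H}_1\oplus\cdots\oplus\mathbb{H}_n$. Then $$w(T)\leq \sum_{k=1}^n\frac{1}{2}\sqrt{\alpha_k^2+\beta_k^2},$$ where $$\alpha_k=\|\mathrm{Re}(A_{kk})\|+\sqrt{\|\mathrm{Re}(A_{kk})\|^2+\sum_{j=1,\,j\neq k}^n\|A_{kj}\|^2},$$ $$\beta_k=\|\mathrm{Im}(A_{kk})\|+\sqrt{\|\mathrm{Im}(A_{kk})\|^2+\sum_{j=1,\,j\neq k}^n\|A_{kj}\|^2}.$$
   Context: $B(\mathbb{H}_j,\mathbb{H}_i)$ denotes the bounded linear operators from $\mathbb{H}_j$ to $\mathbb{H}_i$, and $\|\cdot\|$ on operators is the operator norm. For a bounded operator $S$ on a complex Hilbert space $\mathbb{H}$: $w(S)=\sup\{|\langle Sx,x\rangle| : x\in\mathbb{H}, \|x\|=1\}$ is the numerical radius, $\mathrm{Re}(S)=\frac12(S+S^* )$ and $\mathrm{Im}(S)=\frac1{2i}(S-S^* )$. The direct sum is the Hilbert space direct sum. *)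

(* Defs.v *)
From HB Require Import structures.
From mathcomp Require Import all_boot all_order all_algebra.
From mathcomp Require Import complex.
From mathcomp Require Import boolp classical_sets functions reals topology normedtype.
From mathcomp Require Import ring lra.
Set Implicit Arguments.
Unset Strict Implicit.
Unset Printing Implicit Defensive.
Import Order.TTheory GRing.Theory Num.Theory.
Import numFieldNormedType.Exports.

Local Open Scope classical_set_scope.
Local Open Scope ring_scope.

Section DotLmod.
Variables (C : numClosedFieldType) (U : lmodType C).
Variable f : {dot U for @Num.conj C}.

Lemma dot_CauchySchwarz (u v : U) : `|f u v| ^+ 2 <= f u u * f v v.
Proof.
have [->|v0] := eqVneq v 0.
  by rewrite !linear0r normr0 expr0n /= mulr0.
pose a := f u v / f v v; pose w := u - a *: v.
have vv : f v v != 0 by rewrite dnorm_eq0.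
have ow : f w v = 0 by rewrite linearBl/= linearZl_LR/= /a divfK ?subrr.
have uE : u = w + a *: v by rewrite subrK.
rewrite {}uE; move: w ow {v0} => w ow.
rewrite linearDl/= ow add0r linearZl_LR/= normrM (ger0_norm (dnorm_ge0 _ _)).
have oaw : f w (a *: v) = 0 by rewrite linearZr_LR/= ow mulr0.
rewrite (hnormDd oaw)/=.
rewrite dnormZ mulrDl exprMn mulrA ler_wpDl// ?mulr_ge0 ?dnorm_ge0//.
Qed.

Lemma dot_CauchySchwarz_sqrt (u v : U) :
  `|f u v| <= sqrtC (f u u) * sqrtC (f v v).
Proof.
have fge0 w : 0 <= f w w by rewrite dnorm_ge0.
rewrite -(sqrCK (normr_ge0 _)) -sqrtCM ?nnegrE//.
by rewrite ler_sqrtC ?dot_CauchySchwarz// nnegrE ?mulr_ge0// exprn_ge0.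
Qed.

Lemma dot_triangle (u v : U) :
  sqrtC (f (u + v) (u + v)) <= sqrtC (f u u) + sqrtC (f v v).
Proof.
rewrite -ler_sqr ?nnegrE ?addr_ge0 ?sqrtC_ge0 ?dnorm_ge0//.
rewrite sqrrD !sqrtCK addrAC dnormD lerD2l.
have -> : f u v + (f u v)^* = 'Re (f u v) *+ 2.
  by rewrite ReE -mulr_natr divfK ?pnatr_eq0.
rewrite lerMn2r/=; apply: le_trans (dot_CauchySchwarz_sqrt u v).
by rewrite (leif_Re_Creal (f u v)).
Qed.
End DotLmod.

(* The inner product is linear in its first argument and conjugate-linear in
   the second, and it induces the norm of the underlying Banach space. *)
HB.mixin Record CompleteNormedModule_isHilbert (R : realType) V
    & CompleteNormedModule R[i] V := {
  hdot : {dot V for @Num.conj R[i]} ;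
  hdot_norm : forall x : V, `|x| ^+ 2 = hdot x x
}.

#[short(type="hilbertType")]
HB.structure Definition Hilbert (R : realType) :=
  {V of CompleteNormedModule R[i] V & CompleteNormedModule_isHilbert R V}.

Local Open Scope complex_scope.

(* On a normed module over R[i], `|x| has type R[i] (with zero imaginary part);
   rnorm x is the same number as an element of R. *)
Definition rnorm (R : realType) (V : normedModType R[i]) (x : V) : R :=
  complex.Re `|x|.

Section HilbertTheory.
Variables (R : realType) (H : hilbertType R).
Implicit Types (x y z : H) (t : R).

Lemma rnormE (V : normedModType R[i]) (x : V) : (rnorm x)%:C = `|x|.
Proof. by rewrite RRe_real ?normr_real. Qed.

Lemma rnorm_ge0 (V : normedModType R[i]) (x : V) : 0 <= rnorm x.
Proof. by rewrite -ler0c rnormE. Qed.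

Lemma rnorm_eq0 (V : normedModType R[i]) (x : V) : rnorm x = 0 -> x = 0.
Proof. by move=> x0; apply/eqP; rewrite -normr_eq0 -rnormE x0. Qed.

Definition rdot x y : R := complex.Re (hdot x y).

Lemma rdot_norm x : rdot x x = rnorm x ^+ 2.
Proof.
apply: (@complexI R); rewrite rmorphXn/= rnormE hdot_norm /rdot RRe_real//.
by rewrite ger0_real// dnorm_ge0.
Qed.

Lemma hdotC x y : hdot x y = (hdot y x)^*.
Proof. by rewrite hermC expr0 mul1r. Qed.

Lemma rdotC x y : rdot x y = rdot y x.
Proof. by rewrite /rdot hdotC; case: (hdot y x). Qed.

Lemma rdotDl x y z : rdot (x + y) z = rdot x z + rdot y z.
Proof. by rewrite /rdot linearDl/= raddfD. Qed.

Lemma rdotZl t x y : rdot (t%:C *: x) y = t * rdot x y.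
Proof.
by rewrite /rdot linearZl_LR/=; case: (hdot x y) => a b /=; rewrite mul0r subr0.
Qed.

Lemma rdotDr x y z : rdot z (x + y) = rdot z x + rdot z y.
Proof. by rewrite rdotC rdotDl !(rdotC z). Qed.

Lemma rdotZr t x y : rdot y (t%:C *: x) = t * rdot y x.
Proof. by rewrite rdotC rdotZl (rdotC y). Qed.

Lemma normcRe_le (a : R[i]) : `|complex.Re a| <= complex.Re `|a|.
Proof.
rewrite normc_def/= -sqrtr_sqr ler_sqrt ?lerDl ?sqr_ge0//.
by rewrite addr_ge0 ?sqr_ge0.
Qed.

Lemma normcE (a : R[i]) : (complex.Re `|a|)%:C = `|a|.
Proof. by rewrite RRe_real ?normr_real. Qed.

Lemma realcM (a b : R) : (a * b)%:C = a%:C * b%:C.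
Proof. exact: rmorphM. Qed.

Lemma hdot_CS x y : `|hdot x y| <= `|x| * `|y|.
Proof.
have := dot_CauchySchwarz_sqrt (@hdot R H) x y.
by rewrite -!hdot_norm !sqrCK.
Qed.

Lemma rdot_CS x y : `|rdot x y| <= rnorm x * rnorm y.
Proof.
apply: (le_trans (normcRe_le _)).
by rewrite -lecR normcE realcM !rnormE hdot_CS.
Qed.

Section Riesz.
Variables (f : H -> R[i]) (M : R).
Hypothesis flin : forall a x y, f (a *: x + y) = a * f x + f y.
Hypothesis fbnd : forall x, `|f x| <= M%:C * `|x|.

Let rf x := complex.Re (f x).
Let J x := rdot x x - 2 * rf x.

Let fD x y : f (x + y) = f x + f y.
Proof. by have := flin 1 x y; rewrite scale1r mul1r. Qed.

Let f0 : f 0 = 0.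
Proof. by have /eqP := fD 0 0; rewrite addr0 -subr_eq0 opprD addNKr oppr_eq0 => /eqP. Qed.

Let fZ a x : f (a *: x) = a * f x.
Proof. by have := flin a x 0; rewrite f0 !addr0. Qed.

Let rfD x y : rf (x + y) = rf x + rf y.
Proof. by rewrite /rf fD raddfD. Qed.

Let rfZ t x : rf (t%:C *: x) = t * rf x.
Proof. by rewrite /rf fZ; case: (f x) => a b /=; rewrite mul0r subr0. Qed.

Let rf_le x : `|rf x| <= M * rnorm x.
Proof.
apply: (le_trans (normcRe_le _)).
by rewrite -lecR normcE realcM !rnormE fbnd.
Qed.

Let J_lb : has_inf (range J).
Proof.
split; first by exists (J 0), 0.
exists (- M ^+ 2) => _ [x _ <-]; rewrite /J rdot_norm.
have := rf_le x; rewrite ler_norml => /andP[_ h].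
have := sqr_ge0 (rnorm x - M); nra.
Qed.

Let d := inf (range J).

Let J_ge x : d <= J x.
Proof. by apply: ge_inf; [have [] := J_lb | exists x]. Qed.

Let parallelogram x y : rnorm (x - y) ^+ 2 <= 2 * (J x - d) + 2 * (J y - d).
Proof.
have := J_ge ((2^-1 : R)%:C *: (x + y)).
have -> : x - y = x + (-1)%:C *: y by rewrite rmorphN1 scaleN1r.
rewrite /J -rdot_norm !(rdotDl, rdotDr, rdotZl, rdotZr, rfD, rfZ) (rdotC y x).
lra.
Qed.

Let near_min x y (e : R) : 0 < e -> J x < d + e ^+ 2 ->
  `|rdot x y - rf y| <= e * rnorm y.
Proof.
move=> e0 Jx; set b := rdot x y - rf y.
have q t : - e ^+ 2 < 2 * t * b + t ^+ 2 * rdot y y.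
  have := J_ge (x + t%:C *: y).
  move: Jx; rewrite /J /b !(rdotDl, rdotDr, rdotZl, rdotZr, rfD, rfZ) (rdotC y x).
  lra.
have en : 0 <= e * rnorm y by rewrite mulr_ge0 ?rnorm_ge0 ?ltW.
rewrite -(ler_pXn2r (ltn0Sn 1)) ?nnegrE// real_normK ?num_real// exprMn -rdot_norm.
have [c0|c0] := eqVneq (rdot y y) 0.
  have y0 : y = 0.
    by apply: rnorm_eq0; apply/eqP; rewrite -sqrf_eq0 -rdot_norm c0.
  by rewrite c0 mulr0 /b y0 /rf f0 -[X in rdot x X](scaler0 _ (0:R)%:C) rdotZr mul0r subr0 expr0n.
have cp : 0 < rdot y y by rewrite lt_def c0 rdot_norm sqr_ge0.
have := q (- b / rdot y y).
have -> : 2 * (- b / rdot y y) * b + (- b / rdot y y) ^+ 2 * rdot y y = - (b ^+ 2 / rdot y y).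
  by field.
by rewrite ltrN2 ltr_pdivrMr// => /ltW.
Qed.

Let minseq (n : nat) : {x | J x < d + n.+1%:R^-1}.
Proof.
apply: cid; have [|_ [x _ <-] h] := @inf_adherent _ _ (n.+1%:R^-1) _ J_lb.
  by rewrite invr_gt0.
by exists x.
Qed.

Lemma riesz : exists z, forall y, f y = hdot y z.
Proof.
pose u n : H := sval (minseq n).
have uP n : J (u n) < d + n.+1%:R^-1 by exact: svalP (minseq n).
have natI (r : R) : 0 < r -> exists N, forall n, (N <= n)%N -> n.+1%:R^-1 < r.
  move=> r0; have [N] := ltr_add_invr r0; rewrite add0r => h; exists N => n Nn.
  by apply: le_lt_trans h; rewrite lef_pV2 ?posrE// ler_nat ltnS.
have cu : cauchy (u @ \oo).
  apply: cauchy_exP => e e0.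
  have eR : (complex.Re e)%:C = e by rewrite RRe_real ?gtr0_real.
  have r0 : 0 < complex.Re e by rewrite -ltcR eR.
  set r := complex.Re e in eR r0.
  have [N hN] := natI (r ^+ 2 / 4) (divr_gt0 (exprn_gt0 2 r0) (ltr0n _ 4)).
  exists (u N); exists N => // n /= Nn.
  rewrite -ball_normE /ball_/= -rnormE -eR ltcR.
  rewrite -(ltr_pXn2r (ltn0Sn 1)) ?nnegrE ?rnorm_ge0 ?ltW//.
  apply: (le_lt_trans (parallelogram _ _)).
  have := uP n; have := uP N; have := hN _ (leqnn N); have := hN _ Nn.
  move: (J _) (J _) (N.+1%:R^-1) (n.+1%:R^-1) (r ^+ 2) => a b p q s.
  lra.
have uz : u @ \oo --> lim (u @ \oo) by exact: cauchy_cvg.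
set z := lim _ in uz; exists z.
have rfE y : rf y = rdot y z.
  apply/eqP; rewrite -subr_eq0; apply/negPn/negP => dn0.
  set dl := rf y - rdot y z in dn0.
  have dl0 : 0 < `|dl| by rewrite normr_gt0.
  have s0 : 0 < rnorm y.
    rewrite lt_def rnorm_ge0 andbT; apply: contraNneq dn0 => y0.
    have yy : y = 0 by apply: rnorm_eq0.
    by rewrite /dl yy -[X in rdot X]( scaler0 _ (0:R)%:C) rdotZl mul0r subr0 /rf f0.
  pose r := `|dl| / (4 * rnorm y).
  have r0 : 0 < r by rewrite divr_gt0// mulr_gt0.
  have [N hN] := natI _ (exprn_gt0 2 r0).
  have rC0 : 0 < r%:C by rewrite ltcR.
  have /cvgrPdist_lt /(_ _ rC0) [N' _ hN'] := uz.
  pose n := maxn N N'.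
  have := hN' n; rewrite /= leq_maxr => /(_ isT).
  rewrite -rnormE ltcR => zn.
  have Jn : J (u n) < d + r ^+ 2.
    by apply: (lt_trans (uP n)); rewrite ltrD2l hN// leq_maxl.
  have h1 := near_min y r0 Jn.
  have h2 := rdot_CS (z - u n) y.
  have h3 : rnorm (z - u n) * rnorm y <= r * rnorm y by rewrite ler_pM2r// ltW.
  have h4 : `|dl| <= `|rdot (z - u n) y| + `|rdot (u n) y - rf y|.
    rewrite -normrN; apply: le_trans (ler_normD _ _); rewrite le_eqVlt; apply/orP; left.
    apply/eqP; congr (`|_|); rewrite /dl.
    have -> : z - u n = z + (-1)%:C *: u n by rewrite rmorphN1 scaleN1r.
    rewrite rdotDl rdotZl (rdotC y z); lra.
  have h5 : r * rnorm y = `|dl| / 4.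
    by rewrite /r; field; rewrite gt_eqF.
  lra.
move=> y; have h1 := rfE y; have h2 := rfE ('i *: y).
move: h1 h2; rewrite /rf /rdot fZ linearZl_LR/=.
by case: (f y) => a b; case: (hdot y z) => a' b' /= ->; rewrite !mul0r !mul1r !sub0r => /oppr_inj ->.
Qed.
End Riesz.
End HilbertTheory.

Section BoundedOperators.
Variable R : realType.

Record bop (H K : hilbertType R) := Bop {
  bop_fun :> H -> K ;
  bop_linear : linear bop_fun ;
  bop_bounded : exists M : R, forall x, rnorm (bop_fun x) <= M * rnorm x
}.

Section BopLmodule.
Variables H K : hilbertType R.
Implicit Types A B : bop H K.

HB.instance Definition _ A :=
  GRing.isLinear.Build R[i] H K *:%R (bop_fun A) (bop_linear A).

Lemma bop_eq A B : A =1 B -> A = B.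
Proof.
case: A B => [f lf bf] [g lg bg] /= /funext fg; case: g / fg lg bg => lg bg.
by congr Bop; exact: Prop_irrelevance.
Qed.

HB.instance Definition _ := gen_eqMixin (bop H K).
HB.instance Definition _ := gen_choiceMixin (bop H K).

Lemma rnormD (V : normedModType R[i]) (x y : V) :
  rnorm (x + y) <= rnorm x + rnorm y.
Proof. by rewrite -lecR rmorphD/= !rnormE ler_normD. Qed.

Lemma rnormZ (V : normedModType R[i]) (a : R[i]) (x : V) :
  rnorm (a *: x) = complex.Re `|a| * rnorm x.
Proof. by apply: (@complexI R); rewrite realcM normcE !rnormE normrZ. Qed.

Lemma rnorm0 (V : normedModType R[i]) : rnorm (0 : V) = 0.
Proof. by rewrite /rnorm normr0. Qed.

Fact bop_zero_linear : linear (fun _ : H => 0 : K).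
Proof. by move=> a x y; rewrite scaler0 addr0. Qed.

Fact bop_zero_bounded : exists M : R, forall x : H, rnorm (0 : K) <= M * rnorm x.
Proof. by exists 0 => x; rewrite rnorm0 mul0r. Qed.

Definition bop_zero := Bop bop_zero_linear bop_zero_bounded.

Fact bop_add_linear A B : linear (fun x => A x + B x).
Proof. by move=> a x y; rewrite !linearP scalerDr addrACA. Qed.

Fact bop_add_bounded A B :
  exists M : R, forall x, rnorm (A x + B x) <= M * rnorm x.
Proof.
have [M hM] := bop_bounded A; have [N hN] := bop_bounded B.
exists (M + N) => x; apply: (le_trans (rnormD _ _)).
by rewrite mulrDl lerD.
Qed.

Definition bop_add A B := Bop (bop_add_linear A B) (bop_add_bounded A B).

Fact bop_scale_linear (c : R[i]) A : linear (fun x => c *: A x).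
Proof. by move=> a x y; rewrite linearP scalerDr !scalerA mulrC. Qed.

Fact bop_scale_bounded (c : R[i]) A :
  exists M : R, forall x, rnorm (c *: A x) <= M * rnorm x.
Proof.
have [M hM] := bop_bounded A; exists (complex.Re `|c| * M) => x.
by rewrite rnormZ -mulrA ler_wpM2l// -ler0c normcE.
Qed.

Definition bop_scale c A := Bop (bop_scale_linear c A) (bop_scale_bounded c A).

Fact bop_addA : associative bop_add.
Proof. by move=> A B C; apply: bop_eq => x /=; rewrite addrA. Qed.
Fact bop_addC : commutative bop_add.
Proof. by move=> A B; apply: bop_eq => x /=; rewrite addrC. Qed.
Fact bop_add0 : left_id bop_zero bop_add.
Proof. by move=> A; apply: bop_eq => x /=; rewrite add0r. Qed.
Fact bop_addN : left_inverse bop_zero (bop_scale (-1)) bop_add.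
Proof. by move=> A; apply: bop_eq => x /=; rewrite scaleN1r addNr. Qed.

HB.instance Definition _ :=
  GRing.isZmodule.Build (bop H K) bop_addA bop_addC bop_add0 bop_addN.

Fact bop_scaleA a b A : bop_scale a (bop_scale b A) = bop_scale (a * b) A.
Proof. by apply: bop_eq => x /=; rewrite scalerA. Qed.
Fact bop_scale1 : left_id 1 bop_scale.
Proof. by move=> A; apply: bop_eq => x /=; rewrite scale1r. Qed.
Fact bop_scaleDr : right_distributive bop_scale +%R.
Proof. by move=> a A B; apply: bop_eq => x /=; rewrite scalerDr. Qed.
Fact bop_scaleDl A : {morph bop_scale^~ A : a b / a + b}.
Proof. by move=> a b; apply: bop_eq => x /=; rewrite scalerDl. Qed.

HB.instance Definition _ := GRing.Zmodule_isLmodule.Build R[i] (bop H K)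
  bop_scaleA bop_scale1 bop_scaleDr bop_scaleDl.

(* The set is nonempty and bounded above, so this supremum is a genuine one. *)
Definition opnorm A : R :=
  sup [set rnorm (A x) | x in [set x : H | rnorm x <= 1]].

Lemma adjoint_exists A :
  exists B : bop K H, forall x y, hdot (A x) y = hdot x (B y).
Proof.
have [M hM] := bop_bounded A.
have rz y : {z | forall x, hdot (A x) y = hdot x z}.
  apply: cid; apply: (@riesz _ _ _ (M * rnorm y)) => [a u v|x].
    by rewrite linearP linearDl/= linearZl_LR.
  apply: (le_trans (hdot_CS _ _)).
  by rewrite -!rnormE -!realcM lecR mulrAC ler_wpM2r ?rnorm_ge0.
pose g y := sval (rz y).
have gP x y : hdot (A x) y = hdot x (g y) by exact: (svalP (rz y)).
have inj z1 z2 : (forall x : H, hdot x z1 = hdot x z2) -> z1 = z2.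
  move=> h; apply/eqP; rewrite -subr_eq0 -(dnorm_eq0 (@hdot R H)).
  by rewrite linearBr/= h subrr.
have glin : linear g.
  move=> a u v; apply: inj => x.
  by rewrite -gP !linearDr/= !linearZr_LR/= !gP.
have gbnd : exists N : R, forall y, rnorm (g y) <= N * rnorm y.
  exists `|M| => y.
  have [g0|g0] := eqVneq (rnorm (g y)) 0.
    by rewrite g0 mulr_ge0 ?rnorm_ge0.
  have gp : 0 < rnorm (g y) by rewrite lt_def g0 rnorm_ge0.
  rewrite -(ler_pM2l gp) -expr2 -rdot_norm {1}/rdot -gP.
  apply: (le_trans (ler_norm _)); apply: (le_trans (rdot_CS _ _)).
  rewrite mulrA ler_wpM2r ?rnorm_ge0//; apply: (le_trans (hM _)).
  by rewrite mulrC ler_wpM2l ?ler_norm ?rnorm_ge0.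
by exists (Bop glin gbnd).
Qed.

Definition adjoint A : bop K H := sval (cid (adjoint_exists A)).

Lemma adjointP A x y : hdot (A x) y = hdot x (adjoint A y).
Proof. exact: (svalP (cid (adjoint_exists A))). Qed.

End BopLmodule.

Section Operators.
Variable H : hilbertType R.
Implicit Types S : bop H H.

Definition reop S : bop H H := 2^-1 *: (S + adjoint S).
Definition imop S : bop H H := (2 * 'i)^-1 *: (S - adjoint S).

(* On the zero space the set is empty and the value is sup set0 = 0. *)
Definition numrad S : R :=
  sup [set complex.Re `|hdot (S x) x| | x in [set x : H | rnorm x = 1]].

End Operators.

End BoundedOperators.

Section DirectSum.
Variables (R : realType) (n : nat) (H : 'I_n -> hilbertType R).

(* Hilbert space direct sum: vectors are families, the inner product is the sum
   of those of the components, and the norm is the one it induces. *)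
Definition hsum : Type := forall i, H i.

Implicit Types x y z : hsum.

HB.instance Definition _ := gen_eqMixin hsum.
HB.instance Definition _ := gen_choiceMixin hsum.

Lemma hsum_eq x y : (forall i, x i = y i) -> x = y.
Proof. exact: functional_extensionality_dep. Qed.

Definition hsum_zero : hsum := fun i => 0.
Definition hsum_opp x : hsum := fun i => - x i.
Definition hsum_add x y : hsum := fun i => x i + y i.
Definition hsum_scale (a : R[i]) x : hsum := fun i => a *: x i.

Fact hsum_addA : associative hsum_add.
Proof. by move=> x y z; apply: hsum_eq => i; rewrite /hsum_add addrA. Qed.
Fact hsum_addC : commutative hsum_add.
Proof. by move=> x y; apply: hsum_eq => i; rewrite /hsum_add addrC. Qed.
Fact hsum_add0 : left_id hsum_zero hsum_add.
Proof. by move=> x; apply: hsum_eq => i; rewrite /hsum_add add0r. Qed.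
Fact hsum_addN : left_inverse hsum_zero hsum_opp hsum_add.
Proof. by move=> x; apply: hsum_eq => i; rewrite /hsum_add addNr. Qed.

HB.instance Definition _ :=
  GRing.isZmodule.Build hsum hsum_addA hsum_addC hsum_add0 hsum_addN.

Fact hsum_scaleA a b x : hsum_scale a (hsum_scale b x) = hsum_scale (a * b) x.
Proof. by apply: hsum_eq => i; rewrite /hsum_scale scalerA. Qed.
Fact hsum_scale1 : left_id 1 hsum_scale.
Proof. by move=> x; apply: hsum_eq => i; rewrite /hsum_scale scale1r. Qed.
Fact hsum_scaleDr : right_distributive hsum_scale +%R.
Proof. by move=> a x y; apply: hsum_eq => i; rewrite /hsum_scale scalerDr. Qed.
Fact hsum_scaleDl x : {morph hsum_scale^~ x : a b / a + b}.
Proof. by move=> a b; apply: hsum_eq => i; rewrite /hsum_scale scalerDl. Qed.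

HB.instance Definition _ := GRing.Zmodule_isLmodule.Build R[i] hsum
  hsum_scaleA hsum_scale1 hsum_scaleDr hsum_scaleDl.

Definition hsum_dot x y : R[i] := \sum_(i < n) hdot (x i) (y i).

Fact hsum_dot_bilinear :
  bilinear_for *%R (@Num.conj R[i] \; *%R) hsum_dot.
Proof.
split=> [y a x z|x a y z]; rewrite /hsum_dot /= mulr_sumr -big_split/=.
  by apply: eq_bigr => i _; rewrite linearDl/= linearZl_LR.
by apply: eq_bigr => i _; rewrite linearDr/= linearZr_LR.
Qed.

HB.instance Definition _ := bilinear_isBilinear.Build R[i] hsum hsum R[i]
  *%R (@Num.conj R[i] \; *%R) hsum_dot hsum_dot_bilinear.

Fact hsum_dot_hermitian x y :
  hsum_dot x y = (-1) ^+ false * Num.conj (hsum_dot y x).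
Proof.
rewrite expr0 mul1r /hsum_dot rmorph_sum/=.
by apply: eq_bigr => i _; rewrite hdotC.
Qed.

HB.instance Definition _ := isHermitianSesquilinear.Build R[i] hsum false
  (@Num.conj R[i]) hsum_dot hsum_dot_hermitian.

Fact hsum_dot_gt0 x : x != 0 -> 0 < hsum_dot x x.
Proof.
move=> x0; have ge0 i : 0 <= hdot (x i) (x i) by rewrite dnorm_ge0.
rewrite lt_def /hsum_dot sumr_ge0 ?andbT//.
apply: contra x0 => /eqP s0; apply/eqP/hsum_eq => i.
apply/eqP; rewrite -(dnorm_eq0 (@hdot R (H i))).
move/eqP: s0; rewrite psumr_eq0// => /allP/(_ i).
by rewrite mem_index_enum => /(_ isT).
Qed.

HB.instance Definition _ := isDotProduct.Build R[i] hsum hsum_dot hsum_dot_gt0.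

Definition hsum_norm x : R[i] := sqrtC (hsum_dot x x).

Fact hsum_ler_normD x y : hsum_norm (x + y) <= hsum_norm x + hsum_norm y.
Proof. exact: dot_triangle. Qed.

Fact hsum_normZ (a : R[i]) x : hsum_norm (a *: x) = `|a| * hsum_norm x.
Proof.
rewrite /hsum_norm dnormZ sqrtCM ?nnegrE ?exprn_ge0 ?dnorm_ge0//.
by rewrite sqrCK.
Qed.

Fact hsum_norm_eq0 x : hsum_norm x = 0 -> x = 0.
Proof. by move/eqP; rewrite sqrtC_eq0 dnorm_eq0 => /eqP. Qed.

HB.instance Definition _ := Lmodule_isNormed.Build R[i] hsum
  hsum_ler_normD hsum_normZ hsum_norm_eq0.

Fact hsum_normE x : `|x| ^+ 2 = hsum_dot x x.
Proof. by rewrite sqrtCK. Qed.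


Fact hsum_norm_coord x i : `|x i| <= `|x|.
Proof.
rewrite -ler_sqr ?nnegrE// hsum_normE hdot_norm /hsum_dot (bigD1 i)//= lerDl.
by apply: sumr_ge0 => j _; rewrite dnorm_ge0.
Qed.

Fact hsum_norm_le_sum x : `|x| <= \sum_(i < n) `|x i|.
Proof.
have := @big_ind2 R[i] R[i] (fun a b => 0 <= b /\ a <= b ^+ 2) 0 +%R 0 +%R.
move=> /(_ _ _ 'I_n (index_enum 'I_n) xpredT (fun i => `|x i| ^+ 2) (fun i => `|x i|)).
case=> [|a a' b b' [a0 ab] [b0 bb]|i _|s0 h]; first by rewrite expr0n.
- split; first exact: addr_ge0.
  rewrite sqrrD; apply: (le_trans (lerD ab bb)); rewrite addrAC lerDl.
  by rewrite mulrn_wge0// mulr_ge0.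
- by [].
rewrite -ler_sqr ?nnegrE// hsum_normE /hsum_dot; apply: le_trans h.
by apply: ler_sum => i _; rewrite hdot_norm.
Qed.

Fact hsum_complete (F : set_system hsum) : ProperFilter F -> cauchy F -> cvg F.
Proof.
move=> FF cF.
pose Fi i : set_system (H i) := (fun x : hsum => x i) @ F.
have cFi i : Fi i --> lim (Fi i).
  apply: cauchy_cvg; apply: cauchy_exP => e e0.
  have /cauchyP/(_ e e0)[x Fx] := cF.
  exists (x i).
  have : F [set z : hsum | ball (x i) e (z i)]; last by [].
  apply: filterS Fx => z; rewrite -!ball_normE /ball_/= => xz.
  by apply: le_lt_trans xz; exact: (hsum_norm_coord (x - z) i).
apply/cvg_ex; exists (fun i => lim (Fi i)); apply/cvg_ballP => e e0.
have d0 : 0 < e / n.+1%:R by rewrite divr_gt0.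
have near_i : \forall x \near F, forall i, `|lim (Fi i) - (x : hsum) i| < e / n.+1%:R.
  apply: filter_forall => i.
  have /cvg_ballP/(_ _ d0) := cFi i.
  apply: filterS => y; by rewrite -ball_normE.
apply: filterS near_i => x hx; rewrite -ball_normE /ball_/=.
apply: (le_lt_trans (hsum_norm_le_sum _)).
apply: (@le_lt_trans _ _ (\sum_(i < n) e / n.+1%:R)).
  by apply: ler_sum => i _; exact: ltW (hx i).
rewrite sumr_const card_ord -[ltLHS]mulr_natr -mulrA gtr_pMr// mulrC.
by rewrite ltr_pdivrMr// mul1r ltr_nat.
Qed.

HB.instance Definition _ := Uniform_isComplete.Build hsum hsum_complete.

HB.instance Definition _ :=
  CompleteNormedModule_isHilbert.Build R hsum hsum_normE.

End DirectSum.

Section OperatorMatrix.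
Variables (R : realType) (n : nat) (H : 'I_n -> hilbertType R).
Variable A : forall i j, bop (H j) (H i).

Definition opmx_fun (x : hsum H) : hsum H := fun i => \sum_(j < n) A i j (x j).

Fact opmx_linear : linear opmx_fun.
Proof.
move=> a x y; apply: hsum_eq => i; rewrite /opmx_fun.
rewrite [RHS](_ : _ = a *: (\sum_j A i j (x j)) + \sum_j A i j (y j))//.
rewrite scaler_sumr -big_split/=; apply: eq_bigr => j _.
exact: linearP.
Qed.

Fact opmx_bounded : exists M : R, forall x, rnorm (opmx_fun x) <= M * rnorm x.
Proof.
have hM i j : {M : R | 0 <= M & forall x, rnorm (A i j x) <= M * rnorm x}.
  apply: cid2; have [M hM] := bop_bounded (A i j).
  exists `|M|; rewrite ?normr_ge0// => x; apply: (le_trans (hM x)).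
  by rewrite ler_wpM2r ?rnorm_ge0 ?ler_norm.
pose M i j := s2val (hM i j).
exists (\sum_i \sum_j M i j) => x.
have rsum (V : normedModType R[i]) (g : 'I_n -> V) :
    rnorm (\sum_i g i) <= \sum_i rnorm (g i).
  elim/big_ind2 : _ => [|u a v b ua vb|//]; first by rewrite rnorm0.
  exact: le_trans (rnormD _ _) (lerD ua vb).
have hle (y : hsum H) : rnorm y <= \sum_i rnorm (y i).
  rewrite -lecR rmorph_sum/= rnormE; apply: (le_trans (hsum_norm_le_sum y)).
  by apply: ler_sum => i _; rewrite rnormE.
apply: (le_trans (hle _)); rewrite mulr_suml; apply: ler_sum => i _.
apply: (le_trans (rsum _ _)); rewrite mulr_suml; apply: ler_sum => j _.
apply: (le_trans (s2valP' (hM i j) (x j))).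
rewrite ler_wpM2l ?(s2valP (hM i j))// -lecR !rnormE.
exact: (hsum_norm_coord x j).
Qed.

Definition opmx : bop (hsum H) (hsum H) := Bop opmx_linear opmx_bounded.

End OperatorMatrix.

(* Main.v *)
Require Import Defs.
From mathcomp Require Import all_boot all_order all_algebra.
From mathcomp Require Import complex.
From mathcomp Require Import reals.
From mathcomp Require Import classical_sets normedtype ring lra.
Set Implicit Arguments.
Unset Strict Implicit.
Unset Printing Implicit Defensive.
Import Order.TTheory GRing.Theory Num.Theory.
Local Open Scope ring_scope.
Local Open Scope complex_scope.

(* Split <Tx, x> into the contributions <(Tx)_k, x_k> of the rows.  For a unit
   vector x, with s = |x_k|, the real part of the k-th one is at most
   |Re A_kk| s^2 + (sum_{j != k} |A_kj|^2)^(1/2) s (1 - s^2)^(1/2), and half of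
   alpha_k is the largest eigenvalue of this quadratic form; the imaginary part
   is likewise at most half of beta_k. *)

(** Induction on the sum. Adding a term leaves [2 * (p * q * w) <= p ^+ 2 * v + q ^+ 2 * u], an
    arithmetic-geometric mean inequality once [w ^+ 2 <= u * v] is known. *)
Lemma sum_CauchySchwarz (R : realDomainType) (I : Type) (s : seq I)
    (P : pred I) (a b : I -> R) :
  (\sum_(i <- s | P i) a i * b i) ^+ 2 <=
    (\sum_(i <- s | P i) a i ^+ 2) * (\sum_(i <- s | P i) b i ^+ 2).
Proof.
(* Nonnegativity of both sums of squares is carried along, because the inductive step compares two
   quantities through their squares. *)
suff [] : [/\ 0 <= \sum_(i <- s | P i) a i ^+ 2, 0 <= \sum_(i <- s | P i) b i ^+ 2 &
  (\sum_(i <- s | P i) a i * b i) ^+ 2 <=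
    (\sum_(i <- s | P i) a i ^+ 2) * (\sum_(i <- s | P i) b i ^+ 2)] by [].
elim/big_rec3: _ => [|i w v u _ [u0 v0 wuv]]; first by rewrite expr0n mul0r.
split; rewrite ?addr_ge0 ?sqr_ge0//.
move: (a i) (b i) => p q.
suff : 2 * (p * q * w) <= p ^+ 2 * v + q ^+ 2 * u by nra.
have h0 : 0 <= p ^+ 2 * v + q ^+ 2 * u by apply: addr_ge0; apply: mulr_ge0; rewrite ?sqr_ge0.
apply: (le_trans (ler_norm _)).
rewrite -(ler_pXn2r (ltn0Sn 1)) ?nnegrE// real_normK ?num_real//.
have := sqr_ge0 (p ^+ 2 * v - q ^+ 2 * u).
have := ler_wpM2l (sqr_ge0 (p * q)) wuv.
nra.
Qed.

(** Let [q] be the square root on the right, so that [S = (q - r) * (q + r)]. Multiplying the right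
    side by [s ^+ 2 + t = 1] makes the claim homogeneous: [2 * (y * s) <= (q - r) * s ^+ 2 + (q + r)
    * t]. This is again the arithmetic-geometric mean inequality, since
    [(y * s) ^+ 2 <= S * t * s ^+ 2]. *)
Lemma quadratic_form_le (R : rcfType) (r S s t y : R) :
    0 <= r -> 0 <= S -> 0 <= s -> 0 <= t ->
    y ^+ 2 <= S * t -> s ^+ 2 + t = 1 ->
  r * s ^+ 2 + y * s <= 2^-1 * (r + Num.sqrt (r ^+ 2 + S)).
Proof.
move=> r0 S0 s0 t0 yS st.
have q0 := sqrtr_ge0 (r ^+ 2 + S).
have qE : Num.sqrt (r ^+ 2 + S) ^+ 2 = r ^+ 2 + S.
  by rewrite sqr_sqrtr// addr_ge0 ?sqr_ge0.
move: (Num.sqrt _) q0 qE => q q0 qE.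
have rq : r <= q by rewrite -ler_sqr ?nnegrE// qE lerDl.
suff : 2 * (y * s) <= (q - r) * s ^+ 2 + (q + r) * t by nra.
have h0 : 0 <= (q - r) * s ^+ 2 + (q + r) * t.
  by apply: addr_ge0; apply: mulr_ge0; rewrite ?sqr_ge0 ?subr_ge0 ?addr_ge0.
apply: (le_trans (ler_norm _)).
rewrite -(ler_pXn2r (ltn0Sn 1)) ?nnegrE// real_normK ?num_real//.
have := sqr_ge0 ((q - r) * s ^+ 2 - (q + r) * t).
have := ler_wpM2l (sqr_ge0 s) yS.
have SE : S = (q - r) * (q + r) by rewrite -subr_sqr qE; ring.
rewrite SE; nra.
Qed.

Section OperatorNorm.
Variables (R : realType) (H K : hilbertType R).
Implicit Types A : bop H K.

Lemma rnorm_le_opnorm A (x : H) : rnorm x <= 1 -> rnorm (A x) <= opnorm A.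
Proof.
move=> x1; apply: ub_le_sup; last by exists x.
(* On the zero space [M] may be negative, hence the absolute value. *)
have [M hM] := bop_bounded A; exists `|M| => _ [z /= z1 <-].
apply: (le_trans (hM z)); apply: (le_trans (ler_norm _)).
by rewrite normrM (ger0_norm (rnorm_ge0 _)) ler_piMr.
Qed.

Lemma opnorm_ge0 A : 0 <= opnorm A.
Proof.
by apply: le_trans (rnorm_ge0 (A 0)) (rnorm_le_opnorm A _); rewrite rnorm0 ler01.
Qed.

Lemma rnorm_bop_le A (x : H) : rnorm (A x) <= opnorm A * rnorm x.
Proof.
have [x0|x0] := eqVneq (rnorm x) 0.
  by rewrite (rnorm_eq0 x0) linear0 !rnorm0 mulr0.
have xp : 0 < rnorm x by rewrite lt_def x0 rnorm_ge0.
have nV : complex.Re `|(rnorm x)^-1%:C| = (rnorm x)^-1.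
  by rewrite ger0_norm// lecR invr_ge0 ltW.
have := @rnorm_le_opnorm A ((rnorm x)^-1%:C *: x).
rewrite linearZ/= !rnormZ nV mulVf// => /(_ (lexx _)).
by rewrite ler_pdivrMl// mulrC.
Qed.

End OperatorNorm.

Section CartesianParts.
Variables (R : realType) (H : hilbertType R).
Implicit Types (S : bop H H) (x : H).

Lemma hdot_adjoint S x : hdot (adjoint S x) x = (hdot (S x) x)^*.
Proof. by rewrite hdotC -adjointP. Qed.

(** The adjoint contributes the conjugate number, so averaging leaves the real part. This lets
    Cauchy-Schwarz for [reop S] bound the real part alone. *)
Lemma hdot_reop S x : hdot (reop S x) x = (complex.Re (hdot (S x) x))%:C.
Proof.
rewrite [reop S x](_ : _ = 2^-1 *: (S x + adjoint S x))//.
rewrite linearZl_LR/= linearDl/= hdot_adjoint.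
by rewrite mulrC -ReJ_add.
Qed.

Lemma hdot_imop S x : hdot (imop S x) x = (complex.Im (hdot (S x) x))%:C.
Proof.
rewrite [imop S x](_ : _ = (2 * 'i)^-1 *: (S x - adjoint S x)); last first.
  (* The opposite of an operator is by construction its multiple by -1. *)
  by rewrite -scaleN1r.
rewrite linearZl_LR/= linearBl/= hdot_adjoint.
rewrite subcJ mulrAC mulKf//.
by rewrite mulf_neq0 ?pnatr_eq0// neq0Ci.
Qed.

Lemma normRe_hdot_le S x :
  `|complex.Re (hdot (S x) x)| <= opnorm (reop S) * rnorm x ^+ 2.
Proof.
have := rdot_CS (reop S x) x; rewrite /rdot hdot_reop/= => /le_trans; apply.
by rewrite expr2 mulrA ler_wpM2r ?rnorm_ge0//; exact: (rnorm_bop_le (reop S)).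
Qed.

Lemma normIm_hdot_le S x :
  `|complex.Im (hdot (S x) x)| <= opnorm (imop S) * rnorm x ^+ 2.
Proof.
have := rdot_CS (imop S x) x; rewrite /rdot hdot_imop/= => /le_trans; apply.
by rewrite expr2 mulrA ler_wpM2r ?rnorm_ge0//; exact: (rnorm_bop_le (imop S)).
Qed.

End CartesianParts.

Lemma rnorm_sum (R : realType) (V : normedModType R[i]) (I : Type) (s : seq I)
    (P : pred I) (g : I -> V) :
  rnorm (\sum_(i <- s | P i) g i) <= \sum_(i <- s | P i) rnorm (g i).
Proof.
elim/big_ind2 : _ => [|u a v b ua vb|//]; first by rewrite rnorm0.
exact: le_trans (rnormD _ _) (lerD ua vb).
Qed.

Lemma rnorm_hsum (R : realType) (n : nat) (H : 'I_n -> hilbertType R)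
    (x : hsum H) :
  rnorm x ^+ 2 = \sum_i rnorm (x i) ^+ 2.
Proof.
rewrite -rdot_norm /rdot [hdot x x](_ : _ = \sum_i hdot (x i) (x i))//.
by rewrite raddf_sum; apply: eq_bigr => i _; rewrite -rdot_norm.
Qed.

Theorem theorem3p3 (R : realType) (n : nat) (H : 'I_n -> hilbertType R)
    (A : forall i j : 'I_n, bop (H j) (H i)) :
  let alpha (k : 'I_n) : R :=
    opnorm (reop (A k k)) +
    Num.sqrt (opnorm (reop (A k k)) ^+ 2 +
              \sum_(j < n | j != k) opnorm (A k j) ^+ 2) in
  let beta (k : 'I_n) : R :=
    opnorm (imop (A k k)) +
    Num.sqrt (opnorm (imop (A k k)) ^+ 2 +
              \sum_(j < n | j != k) opnorm (A k j) ^+ 2) in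
  numrad (opmx A) <=
    \sum_(k < n) 2^-1 * Num.sqrt (alpha k ^+ 2 + beta k ^+ 2).
Proof.
(* The coercion is_true encloses the let-ins, which move=> cannot introduce. *)
set alpha := fun k => _; set beta := fun k => _ => /=.
pose E := [set complex.Re `|hdot (opmx A x) x| | x in [set x : hsum H | rnorm x = 1]]%classic.
rewrite -[numrad _]/(sup E).
(* Without unit vectors the direct sum is zero and [sup] takes its default value 0. *)
have [->|E0] := eqVneq E set0.
  by rewrite sup0; apply: sumr_ge0 => k _; rewrite mulr_ge0 ?sqrtr_ge0 ?invr_ge0.
apply: ge_sup; first exact/set0P.
move=> _ [x x1 <-]; have {}x1 : rnorm x = 1 := x1.
have -> : hdot (opmx A x) x = \sum_k hdot (\sum_j A k j (x j)) (x k) by [].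
apply: (@le_trans _ _ (\sum_k complex.Re `|hdot (\sum_j A k j (x j)) (x k)|)).
  rewrite -lecR Defs.normcE rmorph_sum/=; apply: (le_trans (ler_norm_sum _ _ _)).
  by apply: ler_sum => k _; rewrite Defs.normcE.
apply: ler_sum => k _.
rewrite [X in hdot X _](bigD1 k)// linearDl.
set d := hdot (A k k (x k)) (x k); set y := \sum_(j | j != k) A k j (x j).
have S0 : 0 <= \sum_(j | j != k) opnorm (A k j) ^+ 2.
  by apply: sumr_ge0 => j _; exact: sqr_ge0.
have t0 : 0 <= \sum_(j | j != k) rnorm (x j) ^+ 2.
  by apply: sumr_ge0 => j _; exact: sqr_ge0.
have st : rnorm (x k) ^+ 2 + \sum_(j | j != k) rnorm (x j) ^+ 2 = 1.
  by have := rnorm_hsum x; rewrite x1 expr1n (bigD1 k).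
(* Cauchy-Schwarz over the columns other than [k]; the second factor is what [x k] leaves of the
   unit mass. *)
have yS : rnorm y ^+ 2 <= (\sum_(j | j != k) opnorm (A k j) ^+ 2) *
                          (\sum_(j | j != k) rnorm (x j) ^+ 2).
  apply: le_trans (sum_CauchySchwarz _ _ _ _).
  rewrite ler_sqr ?nnegrE ?rnorm_ge0//; last first.
    by apply: sumr_ge0 => j _; rewrite mulr_ge0 ?opnorm_ge0 ?rnorm_ge0.
  by apply: (le_trans (rnorm_sum _ _ _)); apply: ler_sum => j _; exact: rnorm_bop_le.
have cs : complex.Re `|hdot y (x k)| <= rnorm y * rnorm (x k).
  by rewrite -lecR Defs.normcE realcM !rnormE hdot_CS.
(* The quadratic form bound, with [s] the norm of [x k] and the norm of the off-diagonal part [y] as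
   cross coefficient. *)
have ReB : `|complex.Re (d + hdot y (x k))| <= 2^-1 * alpha k.
  apply: le_trans (quadratic_form_le (opnorm_ge0 _) S0 (rnorm_ge0 _) t0 yS st).
  rewrite raddfD/=; apply: (le_trans (ler_normD _ _)); apply: lerD.
    exact: normRe_hdot_le.
  exact: le_trans (normcRe_le _) cs.
have ImB : `|complex.Im (d + hdot y (x k))| <= 2^-1 * beta k.
  apply: le_trans (quadratic_form_le (opnorm_ge0 _) S0 (rnorm_ge0 _) t0 yS st).
  rewrite raddfD/=; apply: (le_trans (ler_normD _ _)); apply: lerD.
    exact: normIm_hdot_le.
  apply: le_trans cs; rewrite normc_def/= -sqrtr_sqr ler_wsqrtr//.
  by rewrite lerDr sqr_ge0.
rewrite normc_def/=.
(* With 1/2 inside the root, the real and imaginary bounds can be compared square by square. *)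
have -> : 2^-1 * Num.sqrt (alpha k ^+ 2 + beta k ^+ 2) =
          Num.sqrt ((2^-1 * alpha k) ^+ 2 + (2^-1 * beta k) ^+ 2).
  by rewrite !exprMn -mulrDr sqrtrM ?sqr_ge0// sqrtr_sqr ger0_norm ?invr_ge0.
have sq_le (a b : R) : `|a| <= b -> a ^+ 2 <= b ^+ 2.
  move=> ab; rewrite -(real_normK (num_real a)) ler_sqr ?nnegrE//.
  exact: le_trans ab.
by apply: ler_wsqrtr; apply: lerD; exact: sq_le.
Qed.
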